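(* Let $A\in\mathrm{GL}_3(\mathbb{Z})$ be conjugate in $\mathrm{GL}_3(\mathbb{Z})$ to a matrix of the block form $$\begin{pmatrix}1 & C\\ 0 & A'\end{pmatrix},$$ where $C=(r,s)\in\mathbb{Z}^{1\times 2}$ and $A'\in\mathrm{GL}_2(\mathbb{Z})$ has real eigenvalues different from $\pm1$. Then the Reidemeister spectrum of $\mathbb{Z}^3\rtimes_A\mathbb{Z}$ is either $\{\infty\}$ or $\{8,\infty\}$. Moreover, if $\mathbb{Z}^2\rtimes_{A'}\mathbb{Z}$ has the $R_\infty$ property, then so does $\mathbb{Z}^3\rtimes_A\mathbb{Z}$.
   Context: For $A\in\mathrm{GL}_n(\mathbb{Z})$, $\mathbb{Z}^n\rtimes_A\mathbb{Z}$ denotes the semidirect product in which a generator of $\mathbb{Z}$ acts on $\mathbb{Z}^n$ by multiplication by $A$. For a group $G$ and an endomorphism $\varphi$ of $G$, say $x\sim_\varphi y$ if there is $z\in G$ with $x=zy\varphi(z)^{-1}$; the Reidemeister number $R(\varphi)$ is the number of equivalence classes of $\sim_\varphi$ ($\infty$ if infinite). The Reidemeister spectrum of $G$ is $\mathrm{Spec}_R(G)=\{R(\varphi)\mid \varphi\in\mathrm{Aut}(G)\}$, and $G$ has the $R_\infty$ property if $\mathrm{Spec}_R(G)=\{\infty\}$. *)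

(* Defs.v *)
From HB Require Import structures.
From mathcomp Require Import all_boot all_order all_algebra all_field.
From mathcomp Require Import finmap.
From mathcomp Require Import boolp classical_sets cardinality constructive_ereal.

Set Implicit Arguments.
Unset Strict Implicit.
Unset Printing Implicit Defensive.

Import Order.TTheory GRing.Theory Num.Theory.

Local Open Scope ring_scope.

(* The carrier of Z^d ><|_A Z for A in GL_d(Z), with d = n.+1: the pair (v, k)
   stands for v t^k, where the generator t acts by t v t^-1 = A v.  Powers of A
   are integer powers in the unit ring of d x d matrices. *)
Definition semidirect (n : nat) (A : 'M[int]_n.+1) (uA : A \in unitmx) : Type :=
  ('cV[int]_n.+1 * int)%type.

HB.instance Definition _ n (A : 'M[int]_n.+1) (uA : A \in unitmx) :=
  Choice.copy (semidirect uA) ('cV[int]_n.+1 * int)%type.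

Section SemidirectGroup.
Variables (n : nat) (A : 'M[int]_n.+1) (uA : A \in unitmx).
Local Notation G := (semidirect uA).

Definition sd_one : G := (0, 0).
Definition sd_mul (x y : G) : G := (x.1 + A ^ x.2 *m y.1, x.2 + y.2).
Definition sd_inv (x : G) : G := (- (A ^ (- x.2) *m x.1), - x.2).

Lemma sd_mulA : associative sd_mul.
Proof.
move=> x y z; congr pair; rewrite /= ?addrA //.
by rewrite mulmxDr addrA exprzDr // mulmxA.
Qed.

Lemma sd_mul1 : left_id sd_one sd_mul.
Proof. by case=> v k; congr pair; rewrite /= ?expr0z ?mul1mx add0r. Qed.

Lemma sd_mulr1 : right_id sd_one sd_mul.
Proof. by case=> v k; congr pair; rewrite /= ?mulmx0 addr0. Qed.

Lemma sd_mulV : left_inverse sd_one sd_inv sd_mul.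
Proof. by case=> v k; congr pair; rewrite /= addNr. Qed.

Lemma sd_mulrV : right_inverse sd_one sd_inv sd_mul.
Proof.
case=> v k; congr pair; rewrite /= ?subrr //.
have AkK : A ^ k *m A ^ (- k) = 1%:M :> 'M_n.+1 
  by rewrite -[LHS](exprzDr uA) subrr expr0z.
by rewrite mulmxN mulmxA AkK mul1mx subrr.
Qed.

HB.instance Definition _ :=
  isGroup.Build G sd_mulA sd_mul1 sd_mulr1 sd_mulV sd_mulrV.

End SemidirectGroup.

Section Reidemeister.
Local Open Scope classical_set_scope.

Definition twisted_conj (G : groupType) (phi : {multiplicative G -> G})
    (x y : G) : Prop :=
  exists z : G, x = (z * y * (phi z)^-1)%g.

Definition reidemeister_classes (G : groupType)
    (phi : {multiplicative G -> G}) : set (set G) :=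
  range (fun y : G => [set x | twisted_conj phi x y]).

Definition reidemeister_number (G : groupType)
    (phi : {multiplicative G -> G}) : \bar nat :=
  if `[< finite_set (reidemeister_classes phi) >]
  then EFin #|` fset_set (reidemeister_classes phi)|%fset
  else +oo%E.

Definition reidemeister_spectrum (G : groupType) : set (\bar nat) :=
  [set r | exists2 phi : {multiplicative G -> G},
             bijective phi & r = reidemeister_number phi].

Definition R_infinity (G : groupType) : Prop :=
  reidemeister_spectrum G = [set +oo%E].

End Reidemeister.

(* Main.v *)
Require Import Defs.
From HB Require Import structures.
From mathcomp Require Import all_boot all_order all_algebra all_field.
From mathcomp Require Import finmap.
From mathcomp Require Import boolp classical_sets cardinality constructive_ereal.
From mathcomp Require Import zify ring.

(* The lattice Z^3 is the centraliser of the commutator subgroup, because no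
   nontrivial power of A fixes im (A - 1); so an automorphism phi restricts to
   some M in GL_3(Z) and maps t to an element of Z^3 t^e with e = 1 or e = -1.
   If e = 1, then R(phi) is infinite since phi induces the identity on Z.  If
   e = -1, then A M A = M, and sorting twisted classes by the parity of the
   t-exponent gives
     R(phi) = |Z^3 / (1 - M) Z^3| + |Z^3 / (1 - A M) Z^3|,
   where each index is |det| (Smith normal form), read as infinity for det = 0.
   In block coordinates M = [[c, *], [0, W]] with c = 1 or c = -1 and
   A' W A' = W.  Cayley-Hamilton then forces det A' = 1 and
   tr W = tr (A' W) = 0, so both determinants are (1 - c)(1 + det W), which is 0
   or 4.  When it is 4, W defines an automorphism of Z^2 ><|_A' Z with
   Reidemeister number 2 + 2. *)

Set Implicit Arguments.
Unset Strict Implicit.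
Unset Printing Implicit Defensive.

Import Order.TTheory GRing.Theory Num.Theory.

Local Open Scope ring_scope.
Local Open Scope classical_set_scope.

(** * Counting twisted conjugacy classes in an arbitrary group *)

Section ReidemeisterGeneral.
Variables (G : groupType) (phi : {multiplicative G -> G}).

Lemma multiplicative1 : phi 1%g = 1%g.
Proof. by apply: (mulgI (phi 1%g)); rewrite -gmulfM !mulg1. Qed.

Lemma multiplicativeV (x : G) : phi (x^-1)%g = (phi x)^-1%g.
Proof.
by apply: (mulIg (phi x)); rewrite -gmulfM !mulVg multiplicative1.
Qed.

Lemma twisted_conjP (x y : G) :
  twisted_conj phi x y <-> exists z : G, (x * phi z = z * y)%g.
Proof.
split=> -[z e]; exists z; first by rewrite e mulgVK.
by rewrite -e mulgK.
Qed.

Lemma twisted_conj_refl (x : G) : twisted_conj phi x x.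
Proof. by apply/twisted_conjP; exists 1%g; rewrite multiplicative1 mulg1 mul1g. Qed.

Lemma twisted_conj_sym (x y : G) : twisted_conj phi x y -> twisted_conj phi y x.
Proof.
case/twisted_conjP=> z e; apply/twisted_conjP; exists z^-1%g.
apply: (mulgI z); apply: (mulIg (phi z)).
by rewrite !mulgA mulgV mul1g -e -!mulgA multiplicativeV mulVg mulg1.
Qed.

Lemma twisted_conj_trans (x y t : G) :
  twisted_conj phi x y -> twisted_conj phi y t -> twisted_conj phi x t.
Proof.
move=> /twisted_conjP[z e] /twisted_conjP[w f]; apply/twisted_conjP.
by exists (z * w)%g; rewrite gmulfM mulgA e -!mulgA f.
Qed.

(** With finitely many classes the absolute value of [f] would take finitely many values, but it
    takes every natural number. *)
Lemma reidemeister_number_infinite (f : G -> int) :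
    (forall x y, twisted_conj phi x y -> f x = f y) ->
    (forall m, exists x, f x = m) ->
  reidemeister_number phi = +oo%E.
Proof.
move=> f_inv f_surj; rewrite /reidemeister_number; case: asboolP => // fin.
(* [xget] picks a representative of a class; its default [1] never intervenes there, since a class
   contains its base point. *)
pose h (S : set G) := `|f (xget 1%g S)|%N.
have hE y : h [set x | twisted_conj phi x y] = `|f y|%N.
  rewrite /h; congr absz; apply: f_inv.
  by case: xgetP => [x _ //|/(_ y) []]; apply: twisted_conj_refl.
case: infinite_nat; apply: sub_finite_set (finite_image h fin) => n _.
have [y fy] := f_surj n%:Z.
exists [set x | twisted_conj phi x y]; first by exists y.
by rewrite hE fy.
Qed.

(** The twisted classes are exactly the fibres of [q], none of them empty, so they correspond
    bijectively to [T]. *)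
Lemma reidemeister_number_finite (T : finType) (q : G -> T) :
    (forall x y, twisted_conj phi x y <-> q x = q y) ->
    (forall t, exists x, q x = t) ->
  reidemeister_number phi = EFin #|T|.
Proof.
move=> q_conj q_surj.
have clsE : reidemeister_classes phi = (fun t => q @^-1` [set t]) @` [set: T].
  apply/seteqP; split=> S /=.
    by case=> y _ <-; exists (q y) => //; apply/seteqP; split=> x /q_conj.
  case=> t _ <-; have [y <-] := q_surj t.
  by exists y => //; apply/seteqP; split=> x /q_conj.
have card_cls : (reidemeister_classes phi #= `I_#|T|)%card.
  rewrite clsE; apply: card_eq_trans (inj_card_eq _) _.
    move=> s t _ _ /seteqP[+ _]; have [x <-] := q_surj s.
    by move=> /(_ x erefl).
  rewrite card_eq_sym; apply: card_eq_trans card_II _.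
  have -> : [set: T] = enum_val @` [set: 'I_#|T|].
    by apply/seteqP; split=> // t _; exists (enum_rank t); rewrite ?enum_rankK.
  by rewrite card_eq_sym; apply: inj_card_eq => i j _ _; apply: enum_val_inj.
rewrite /reidemeister_number asboolT; last by exists #|T|.
by rewrite (card_fset_set card_cls).
Qed.

End ReidemeisterGeneral.

(** * Cokernels of square integer matrices *)

Section Cokernel.
Variables (n : nat) (N : 'M[int]_n).

Lemma absz_det_unitmx (L : 'M[int]_n) : L \in unitmx -> `|\det L|%N = 1%N.
Proof. by rewrite unitmxE => /orP[] /eqP ->. Qed.

Lemma smith_diag : exists (L R : 'M[int]_n) (d : 'I_n -> int),
  [/\ L \in unitmx, R \in unitmx & N = L *m diag_mx (\row_i d i) *m R].
Proof.
have [L uL [R uR [d _ NE]]] := int_Smith_normal_form N.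
exists L, R, (fun i : 'I_n => d`_i); split=> //; rewrite [LHS]NE; congr (_ *m _ *m _).
by apply/matrixP=> i j; rewrite !mxE.
Qed.

(** Write N = L D R in Smith form. The invertible R is absorbed into [w], so the class of u is read
    off from the coordinates of L^-1 u modulo the diagonal entries d_i. The product of the |d_i| is
    |det N|. *)
Lemma coker_fintype : \det N != 0 ->
  exists (T : finType) (q : 'cV[int]_n -> T),
    [/\ #|T| = `|\det N|%N, forall t, exists u, q u = t &
        forall u v, q u = q v <-> exists w, u - v = N *m w].
Proof.
have [L [R [d [uL uR NE]]]] := smith_diag.
have detE : `|\det N|%N = (\prod_(i < n) `|d i|)%N.
  rewrite NE !det_mulmx !abszM (absz_det_unitmx uL) (absz_det_unitmx uR) mul1n muln1 det_diag.
  rewrite (big_morph absz abszM (erefl : `|1 : int|%N = 1%N)).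
  by apply: eq_bigr => i _; rewrite mxE.
rewrite -absz_eq0 detE => nz.
have d_gt0 i : (0 < `|d i|)%N.
  by rewrite lt0n; apply: contraNneq nz => di0; rewrite (bigD1 i) //= di0 mul0n.
have dnz i : d i != 0 by rewrite -absz_gt0.
(* As d_i is nonzero, the bound is |d_i|; the successor form is the one [inord] requires. *)
pose T := {dffun forall i : 'I_n, 'I_(`|d i|.-1.+1)}.
pose q (u : 'cV[int]_n) : T := [ffun i => inord (absz (modz ((invmx L *m u) i 0) (d i)))].
have qE u v : q u = q v <-> forall i : 'I_n,
    modz ((invmx L *m u) i 0) (d i) = modz ((invmx L *m v) i 0) (d i).
  split=> [/ffunP quv i | e]; last by apply/ffunP=> i; rewrite !ffunE e.
  have := quv i; rewrite !ffunE => /(congr1 val) /=.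
  have md m : (0 <= (m %% d i)%Z) by rewrite modz_ge0 ?dnz.
  have ml m : (`|(m %% d i)%Z| < `|d i|.-1.+1)%N.
    by rewrite prednK ?d_gt0 // -ltz_nat gez0_abs // abszE ltz_mod // dnz.
  by rewrite !inordK // => /(congr1 Posz); rewrite !gez0_abs.
exists T, q; split.
- rewrite card_dep_ffun foldrE big_map big_enum /=.
  by apply: eq_bigr => i _; rewrite card_ord prednK ?d_gt0.
- move=> t; exists (L *m \col_i (t i : nat)%:Z); apply/ffunP=> i.
  rewrite ffunE mulKmx // mxE; apply: val_inj => /=.
  have lt_td : ((t i : nat) < `|d i|)%N.
    by rewrite (leq_trans (ltn_ord _)) // prednK ?d_gt0.
  rewrite -modz_abs modz_small; last by rewrite /= ltz_nat.
  exact: inordK (ltn_ord _).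
move=> u v; rewrite qE.
have [y uvE] : exists y, u - v = L *m y.
  by exists (invmx L *m (u - v)); rewrite mulKVmx.
have yE i : y i 0 = (invmx L *m u) i 0 - (invmx L *m v) i 0.
  by rewrite -[y](mulKmx uL) -uvE mulmxBr [LHS]mxE [X in _ + X]mxE.
split=> [e | [w vE] i].
  exists (invmx R *m \col_i divz (y i 0) (d i)).
  rewrite NE !mulmxA mulmxK // -mulmxA uvE; congr (_ *m _).
  apply/matrixP=> i j; rewrite (ord1 j) mul_diag_mx !mxE mulrC divzK //.
  by rewrite yE -eqz_mod_dvd; apply/eqP.
apply/eqP; rewrite eqz_mod_dvd -yE -[y](mulKmx uL) -uvE vE NE -!mulmxA mulKmx // mul_diag_mx !mxE.
exact: dvdz_mulr.
Qed.

(** Some d_i vanishes, so adding an element of the image of N does not change the i-th coordinate of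
    L^-1 u. *)
Lemma coker_infinite : \det N = 0 ->
  exists g : 'cV[int]_n -> int,
    (forall m, exists u, g u = m) /\ forall u w, g (u + N *m w) = g u.
Proof.
have [L [R [d [uL uR NE]]]] := smith_diag.
rewrite {1}NE !det_mulmx det_diag => /eqP.
rewrite !mulf_eq0 -!absz_eq0 (absz_det_unitmx uL) (absz_det_unitmx uR) /= orbF absz_eq0.
case/prodf_eq0=> i _; rewrite mxE => /eqP di0.
exists (fun u => (invmx L *m u) i 0); split=> [m | u w].
  by exists (L *m \col_j m); rewrite mulKmx // mxE.
by rewrite mulmxDr NE -!mulmxA mulKmx // mul_diag_mx !mxE di0 mul0r addr0.
Qed.

End Cokernel.

(** * Additive maps of lattices as integer matrices *)

Section AdditiveMaps.

Lemma morphD_additive (V W : zmodType) (f : V -> W) :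
  {morph f : x y / x + y} -> exists F : {additive V -> W}, forall x, f x = F x.
Proof.
move=> fD; have fB : {morph f : x y / x - y}.
  by move=> x y; apply/eqP; rewrite eq_sym subr_eq -fD subrK.
pose F : {additive V -> W} := HB.pack f (GRing.isZmodMorphism.Build V W f fB).
by exists F.
Qed.

(** Over the integers additivity already gives linearity; the columns of M are the images of the
    standard basis. *)
Lemma morphD_mulmx (m n : nat) (f : 'cV[int]_n -> 'cV[int]_m) :
  {morph f : x y / x + y} -> exists M : 'M_(m, n), forall v, f v = M *m v.
Proof.
case/morphD_additive=> F fF; exists (\matrix_(i, j) F (delta_mx j 0) i 0) => v.
rewrite fF {1}[v]matrix_sum_delta raddf_sum; apply/matrixP=> i j.
rewrite (ord1 j) summxE mxE; apply: eq_bigr => l _; rewrite big_ord1.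
by rewrite -{1}[v l 0]intz scaler_int raddfMz -scaler_int intz !mxE mulrC.
Qed.

Lemma mulmx_delta_inj (R : pzRingType) (m n : nat) (X Y : 'M[R]_(m, n)) :
  (forall j, X *m delta_mx j (0 : 'I_1) = Y *m delta_mx j 0) -> X = Y.
Proof.
move=> XY; apply/matrixP=> i j.
by have := XY j; rewrite -!colE => /colP/(_ i); rewrite !mxE.
Qed.

End AdditiveMaps.

(** * Automorphisms of the semidirect product and their twisted classes *)

Section Semidirect.
Variables (n : nat) (A : 'M[int]_n.+1) (uA : A \in unitmx).
Local Notation G := (semidirect uA).

Lemma semidirect_mulE (x y : G) :
  (x * y)%g = (x.1 + A ^ x.2 *m y.1, x.2 + y.2) :> G.
Proof. by []. Qed.

Section Automorphism.
Variable phi : {multiplicative G -> G}.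
Hypothesis phi_bij : bijective phi.
Hypothesis A_free : forall k, A ^ k *m (A - 1) = A - 1 -> k = 0.

(* [Z^n] is the centraliser of the commutators [t w t^-1 w^-1 = (A - 1) w], so
   it is preserved by automorphisms. *)
Lemma automorphism_lattice v : (phi ((v, 0) : G)).2 = 0.
Proof.
have [psi phiK psiK] := phi_bij.
have psiM := can2_gmulfM phiK psiK.
set g := phi _; apply: A_free; apply: mulmx_delta_inj => j.
set w := delta_mx j 0; pose c : G := ((A - 1) *m w, 0).
pose t : G := (0, 1); pose a : G := (w, 0).
have commE : (c * (a * t) = t * a)%g.
  rewrite !semidirect_mulE /= !mulmx0 !expr0z expr1z !mul1mx !addr0 !add0r.
  by rewrite mulmxBl mul1mx subrK.
have psi_c2 : (psi c).2 = 0.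
  have := congr1 (fun x : G => (psi x).2) commE; rewrite !psiM /=; lia.
have : (g * c = c * g)%g.
  rewrite -[c]psiK -!gmulfM; congr (phi _).
  rewrite !semidirect_mulE /= psi_c2 !expr0z !mul1mx !addr0; congr pair.
  exact: addrC.
move/(congr1 fst) => /=; rewrite expr0z mul1mx addrC => /addIr.
by rewrite mulmxA.
Qed.

(** [M] is the restriction to the lattice and [e] the induced multiplier on the quotient Z, a unit
    by surjectivity. *)
Lemma automorphism_structure :
  exists (M : 'M[int]_n.+1) (e : int),
    [/\ M \in unitmx, e = 1 \/ e = -1,
        forall v, phi ((v, 0) : G) = (M *m v, 0),
        forall x, (phi x).2 = e * x.2 &
        M *m A = A ^ e *m M].
Proof.
have [psi phiK psiK] := phi_bij.
have [|M fM] := @morphD_mulmx _ _ (fun v => (phi ((v, 0) : G)).1).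
  move=> v w; have -> : (v + w, 0) = (((v, 0) : G) * ((w, 0) : G))%g :> G.
    by rewrite semidirect_mulE /= expr0z mul1mx addr0.
  by rewrite gmulfM /= automorphism_lattice expr0z mul1mx.
have phiM v : phi ((v, 0) : G) = (M *m v, 0).
  by rewrite [LHS]surjective_pairing automorphism_lattice fM.
have [|E hE] := @morphD_additive _ _ (fun k => (phi ((0, k) : G)).2).
  move=> k l; have -> : (0, k + l) = (((0, k) : G) * ((0, l) : G))%g :> G.
    by rewrite semidirect_mulE /= mulmx0 addr0.
  by rewrite gmulfM.
have phi2 x : (phi x).2 = E 1 * x.2.
  case: x => v k; have -> : (v, k) = (((v, 0) : G) * ((0, k) : G))%g :> G.
    by rewrite semidirect_mulE /= mulmx0 addr0 add0r.
  rewrite gmulfM /= automorphism_lattice !add0r hE.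
  by rewrite -{1}[k]intz raddfMz -mulrzr intz.
have E1 : E 1 = 1 \/ E 1 = -1.
  have : E 1 \is a GRing.unit.
    by apply/unitrPr; exists (psi (0, 1)).2; rewrite -phi2 psiK.
  by case/orP=> /eqP; [left|right].
exists M, (E 1); split=> //.
  (* The inverse of [M] comes from [psi], which also preserves the lattice because [phi] multiplies
     [t]-exponents by a unit. *)
  pose N := \matrix_(i, j) (psi ((delta_mx j 0, 0) : G)).1 i 0.
  apply: (proj1 (@mulmx1_unit _ _ M N _)).
  apply: mulmx_delta_inj => j; rewrite -mulmxA.
  set x := psi ((delta_mx j 0, 0) : G).
  have x2 : x.2 = 0.
    have /eqP := phi2 x; rewrite psiK /= eq_sym.
    by case: E1 => ->; rewrite ?mulN1r ?oppr_eq0 ?mul1r => /eqP.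
  have -> : N *m delta_mx j 0 = x.1.
    by rewrite -colE; apply/matrixP=> i l; rewrite !mxE (ord1 l).
  have := psiK (delta_mx j 0, 0); rewrite -/x [x]surjective_pairing x2 phiM.
  by case=> ->; rewrite mul1mx.
(* The relation follows by applying [phi] to t v = (A v) t and comparing lattice parts. *)
apply: mulmx_delta_inj => j; rewrite -!mulmxA; set v := delta_mx j 0.
pose t : G := (0, 1).
have : (t * ((v, 0) : G) = ((A *m v, 0) : G) * t)%g.
  by rewrite !semidirect_mulE /= expr0z expr1z mulmx0 !addr0 !add0r.
move/(congr1 phi); rewrite !gmulfM !phiM => /(congr1 fst) /=.
by rewrite phi2 /= mulr1 expr0z mul1mx [LHS]addrC => /addIr.
Qed.

End Automorphism.

Lemma reidemeister_number_fix (phi : {multiplicative G -> G}) :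
  (forall x, (phi x).2 = x.2) -> reidemeister_number phi = +oo%E.
Proof.
move=> phi2; apply: (@reidemeister_number_infinite _ _ (fun x : G => x.2)).
  move=> x y /twisted_conjP[z] /(congr1 snd) /=.
  by rewrite phi2 [RHS]addrC => /addIr.
by move=> m; exists (0, m).
Qed.

(** * Automorphisms that invert the exponent of [t] *)

Section Flip.
Variables (phi : {multiplicative G -> G}) (M : 'M[int]_n.+1).
Hypothesis phiM : forall v, phi ((v, 0) : G) = (M *m v, 0).
Hypothesis phi2 : forall x, (phi x).2 = - x.2.

Lemma flip_twisted_conj u v k :
  twisted_conj phi ((u, k) : G) ((v, k) : G) <->
  exists w, u - v = (1 - A ^ k *m M) *m w.
Proof.
split=> [/twisted_conjP[[w l] e] | [w e]].
  (* Comparing [t]-exponents gives k - l = l + k, so the conjugator lies in the lattice. *)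
  have l0 : l = 0.
    have := congr1 snd e; rewrite /= phi2 /= => e2; lia.
  move: e; rewrite l0 phiM => /(congr1 fst) /=; rewrite expr0z mul1mx => e.
  exists w; rewrite mulmxBl mul1mx -mulmxA.
  by apply/eqP; rewrite subr_eq addrAC eq_sym subr_eq e.
apply/twisted_conjP; exists (w, 0); rewrite phiM !semidirect_mulE /= expr0z.
rewrite mul1mx addr0 add0r; congr pair.
move: e; rewrite mulmxBl mul1mx -mulmxA => /eqP.
by rewrite subr_eq addrAC eq_sym subr_eq => /eqP.
Qed.

(* Conjugating by [t^l] shifts the [t]-exponent by [2 l], so only its parity [b]
   matters, and then only the class modulo the image of [1 - A^b M]. *)
Lemma flip_normal_form (x : G) :
  exists p : 'cV[int]_n.+1 * bool,
    twisted_conj phi x ((p.1, (p.2 : nat)%:Z) : G).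
Proof.
have [l [b x2]] : exists l (b : bool), x.2 = l + l + (b : nat)%:Z.
  exists (x.2 %/ 2)%Z, ((x.2 %% 2)%Z != 0); lia.
pose z : G := (0, - l); pose y := (z * x * (phi z)^-1)%g.
exists (y.1, b); suff -> : ((y.1, (b : nat)%:Z) : G) = y.
  by apply: twisted_conj_sym; exists z.
rewrite [RHS]surjective_pairing; congr pair.
rewrite /y /= phi2 /= x2; lia.
Qed.

Lemma flip_twisted_parity u v (b c : bool) :
  twisted_conj phi ((u, (b : nat)%:Z) : G) ((v, (c : nat)%:Z) : G) -> b = c.
Proof.
move=> /twisted_conjP[z] /(congr1 snd) /=; rewrite phi2.
by case: b c => -[] //= e; lia.
Qed.

(** Normal forms are chosen arbitrarily, so the one of v t^b has lattice part v only up to the image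
    of 1 - A^b M. *)
Lemma flip_invariant : exists nf : G -> 'cV[int]_n.+1 * bool,
  (forall x y, twisted_conj phi x y <->
     (nf x).2 = (nf y).2 /\
     exists w, (nf x).1 - (nf y).1 = (1 - A ^+ (nf x).2 *m M) *m w) /\
  forall v (b : bool), (nf (v, (b : nat)%:Z)).2 = b /\
    exists w, (nf (v, (b : nat)%:Z)).1 = v + (1 - A ^+ b *m M) *m w.
Proof.
have [nf nfP] := choice flip_normal_form.
have conj_nf x y : twisted_conj phi x y <-> twisted_conj phi
    (((nf x).1, ((nf x).2 : nat)%:Z) : G) (((nf y).1, ((nf y).2 : nat)%:Z) : G).
  split=> xy.
    apply: twisted_conj_trans (twisted_conj_sym (nfP x)) _.
    exact: twisted_conj_trans xy (nfP y).
  apply: twisted_conj_trans (nfP x) _.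
  exact: twisted_conj_trans xy (twisted_conj_sym (nfP y)).
exists nf; split=> [x y | v b].
  rewrite conj_nf; split=> [xy | [e [w f]]].
    have e := flip_twisted_parity xy; split=> //.
    by move: xy; rewrite -e => /flip_twisted_conj.
  by rewrite -e; apply/flip_twisted_conj; exists w.
have := nfP (v, (b : nat)%:Z); case: (nf _) => u c /= vu.
have bc := flip_twisted_parity vu; split=> //; move: vu; rewrite -bc.
case/flip_twisted_conj=> w e; exists (- w).
by rewrite mulmxN -e opprB addrC subrK.
Qed.

(** The classes are parametrised by the disjoint union of the two cokernels, one for each parity. *)
Lemma reidemeister_number_flip (d0 d1 : int) :
    \det (1 - M) = d0 -> \det (1 - A *m M) = d1 -> d0 != 0 -> d1 != 0 ->
  reidemeister_number phi = EFin (`|d0| + `|d1|)%N.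
Proof.
move=> <- <- /coker_fintype[T0 [q0 [<- q0_surj q0P]]].
move=> /coker_fintype[T1 [q1 [<- q1_surj q1P]]].
have [nf [nfP nf_surj]] := flip_invariant.
pose q x := let: (u, b) := nf x in if b then inr (q1 u) else inl (q0 u).
rewrite (@reidemeister_number_finite _ _ (T0 + T1)%type q) ?card_sum //.
  move=> x y; rewrite nfP /q; case: (nf x) (nf y) => u [] [v []] //=.
  - rewrite expr1; split=> [[_ /q1P->] // | [] /q1P]; by split.
  - by split=> [[]|].
  - by split=> [[]|].
  - rewrite expr0 mul1mx; split=> [[_ /q0P->] // | [] /q0P]; by split.
move=> [t0 | t1].
  have [u <-] := q0_surj t0; exists (u, 0); rewrite /q.
  have /= [] := nf_surj u false; case: (nf _) => v b /= -> [w].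
  rewrite expr0 mul1mx => ->; congr inl; apply/q0P.
  by exists w; rewrite addrC addKr.
have [u <-] := q1_surj t1; exists (u, 1); rewrite /q.
have /= [] := nf_surj u true; case: (nf _) => v b /= -> [w].
rewrite expr1 => ->; congr inr; apply/q1P.
by exists w; rewrite addrC addKr.
Qed.

(** One infinite cokernel suffices: its integer invariant is extended by 0 to the other parity. *)
Lemma reidemeister_number_flip_infinite (b : bool) :
  \det (1 - A ^+ b *m M) = 0 -> reidemeister_number phi = +oo%E.
Proof.
case/coker_infinite=> g [g_surj gP].
have [nf [nfP nf_surj]] := flip_invariant.
pose f x := if (nf x).2 == b then g (nf x).1 else 0.
apply: (@reidemeister_number_infinite _ _ f) => [x y | m].
  rewrite nfP /f => -[e [w /eqP]]; rewrite subr_eq addrC -e => /eqP->.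
  by case: eqP => // ->; rewrite gP.
have [u <-] := g_surj m; exists (u, (b : nat)%:Z); rewrite /f.
have /= [-> [w ->]] := nf_surj u b.
by rewrite eqxx gP.
Qed.

End Flip.

(** A converse to [automorphism_structure] for e = -1: the map v t^k to (M v) t^-k is a morphism
    because M A^k = A^-k M for every integer k. *)
Lemma flip_multiplicative (M : 'M[int]_n.+1) :
    M \in unitmx -> M *m A = A ^ (-1) *m M ->
  exists phi : {multiplicative G -> G},
    [/\ bijective phi, forall v, phi ((v, 0) : G) = (M *m v, 0) &
        forall x, (phi x).2 = - x.2].
Proof.
move=> uM MA.
have MAV : M *m A ^ (-1) = A *m M.
  have AV : A *m A ^ (-1) = 1%:M by rewrite exprN1; apply: mulmxV.
  have AMA : A *m M *m A = M by rewrite -mulmxA MA mulmxA AV mul1mx.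
  by rewrite -{1}AMA -mulmxA AV mulmx1.
have MAk k : M *m A ^ k = A ^ (- k) *m M.
  elim: k => [|k IH|k IH]; first by rewrite oppr0 !expr0z mulmx1 mul1mx.
    by rewrite intS opprD !exprzDr // expr1z -!mulmxE mulmxA MA -!mulmxA IH.
  rewrite opprK intS opprD !exprzDr // expr1z -!mulmxE.
  by rewrite mulmxA MAV -!mulmxA IH opprK.
pose f (x : G) : G := (M *m x.1, - x.2).
have fM : {morph f : x y / (x * y)%g}.
  move=> x y; rewrite /f !semidirect_mulE /= opprD; congr pair.
  by rewrite mulmxDr !mulmxA MAk.
pose phi : {multiplicative G -> G} := HB.pack f (isMultiplicative.Build G G f fM).
exists phi; split=> //=.
  exists (fun x : G => (invmx M *m x.1, - x.2)) => -[v k].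
    by rewrite /f /= opprK mulKmx.
  by rewrite /f /= opprK mulKVmx.
Qed.

End Semidirect.

(** * Determinants, traces and eigenvalues of the matrices involved *)

Section Matrices.

Lemma det_mx22 (R : comNzRingType) (X : 'M[R]_2) :
  \det X = X 0 0 * X 1 1 - X 0 1 * X 1 0.
Proof.
rewrite (expand_det_row _ 0) !big_ord_recl big_ord0 addr0 /cofactor !det_mx11.
rewrite !mxE /= expr0 mul1r expr1 mulN1r mulrN; congr (_ * _ - _ * _).
- by congr (X _ _); apply: val_inj.
- by congr (X _ _); apply: val_inj.
- by congr (X _ _); apply: val_inj.
Qed.

Lemma mxtrace_mx22 (R : pzRingType) (X : 'M[R]_2) : \tr X = X 0 0 + X 1 1.
Proof.
rewrite /mxtrace !big_ord_recl big_ord0 addr0; congr (_ + X _ _);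
by apply: val_inj.
Qed.

Lemma det_scalar_sub_mx22 (R : comNzRingType) (a : R) (X : 'M[R]_2) :
  \det (a%:M - X) = a ^+ 2 - a * \tr X + \det X.
Proof.
rewrite !det_mx22 mxtrace_mx22 !mxE /=.
have expand (p q r s : R) : (a *+ 1 - p) * (a *+ 1 - s) -
    (a *+ 0 - q) * (a *+ 0 - r) = a ^+ 2 - a * (p + s) + (p * s - q * r).
  ring.
exact: expand.
Qed.

(** Multiplied by X, this is Cayley-Hamilton in dimension two. *)
Lemma adj_mx22 (R : comNzRingType) (X : 'M[R]_2) : \adj X = (\tr X)%:M - X.
Proof.
apply/matrixP=> i j; rewrite !mxE /cofactor det_mx11 !mxE mxtrace_mx22.
have ord2 (k : 'I_2) : k = 0 \/ k = 1.
  by case: k => [[|[|//]] ?]; [left|right]; apply: val_inj.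
have lift20 (k : 'I_2) : lift k 0 = rev_ord k :> 'I_2.
  by case: (ord2 k) => ->; apply: val_inj.
have rev0 : rev_ord 0 = 1 :> 'I_2 by apply: val_inj.
have rev1 : rev_ord 1 = 0 :> 'I_2 by apply: val_inj.
rewrite !lift20; case: (ord2 i) (ord2 j) => -> [] ->; rewrite ?rev0 ?rev1 /=.
- by rewrite expr0 mul1r mulr1n addrC addKr.
- by rewrite expr1 mulN1r mulr0n sub0r.
- by rewrite expr1 mulN1r mulr0n sub0r.
- by rewrite sqrrN expr1n mul1r mulr1n addrK.
Qed.

Lemma det_sub_conj (R : comUnitRingType) (n : nat) (P X : 'M[R]_n) :
  P \in unitmx -> \det (1%:M - P *m X *m invmx P) = \det (1%:M - X).
Proof.
move=> uP; have -> : 1%:M - P *m X *m invmx P = P *m (1%:M - X) *m invmx P.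
  by rewrite mulmxBr mulmx1 mulmxBl mulmxV.
by rewrite !det_mulmx mulrAC -det_mulmx mulmxV // det1 mul1r.
Qed.

Lemma eigenvalue_det_sub (n : nat) (B : 'M[int]_n) (a : int) :
  \det (a%:M - B) = 0 -> eigenvalue (map_mx intr B : 'M[algC]_n) a%:~R.
Proof.
move/eqP/det0P=> [v vN0]; rewrite mulmxBr mul_mx_scalar => /eqP.
rewrite subr_eq0 => /eqP vB; apply/eigenvalueP; exists (map_mx intr v).
  by rewrite -map_mxM -vB map_mxZ.
apply: contra_neq vN0 => /matrixP v0; apply/matrixP=> i j.
by have := v0 i j; rewrite !mxE => /eqP; rewrite intr_eq0 => /eqP.
Qed.

(** On an eigenvector for a the equation reads (a^k - 1)(a - 1) = 0, so a^k = 1; for k nonzero this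
    gives |a| = 1, which a real a other than 1 and -1 excludes. *)
Lemma eigenvalue_free (n : nat) (A : 'M[int]_n.+1) (a : algC) (k : int) :
    A \in unitmx -> eigenvalue (map_mx intr A) a ->
    a \is Num.real -> a != 1 -> a != -1 ->
  A ^ k *m (A - 1) = A - 1 -> k = 0.
Proof.
move=> uA /eigenvalueP[u uAa uN0] a_real a1 aN1.
have free (m : nat) : A ^+ m *m (A - 1) = A - 1 -> m = 0%N.
  have uAm : u *m map_mx intr (A ^+ m) = a ^+ m *: u.
    elim: m => [|m IH]; first by rewrite !expr0 map_mx1 mulmx1 scale1r.
    by rewrite exprS -mulmxE map_mxM mulmxA uAa -scalemxAl IH scalerA -exprS.
  have uA1 : u *m map_mx intr (A - 1) = (a - 1) *: u.
    by rewrite map_mxB map_mx1 mulmxBr mulmx1 uAa scalerBl scale1r.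
  move/(congr1 (fun X => u *m map_mx intr X)); rewrite map_mxM mulmxA uAm.
  rewrite -scalemxAl uA1 => /eqP; rewrite -subr_eq0 -{2}[(a - 1) *: u]scale1r.
  rewrite -scalerBl !scaler_eq0 (negPf uN0) (subr_eq0 a) (negPf a1) !orbF.
  rewrite subr_eq0 => /eqP am1; apply: contraNeq aN1; rewrite -lt0n => m_gt0.
  have /eqP : `|a| ^+ m = 1 by rewrite -normrX am1 normr1.
  by rewrite pexpr_eq1 // real_eqr_norml // (negPf a1) ler01 andbT.
case: (intP k) => [//|m|m] E.
  by have := free _ E.
(* For a negative exponent, multiplying by the opposite power of A reduces to the positive case. *)
suff /free : A ^+ m.+1 *m (A - 1) = A - 1 by [].
have AV : A ^+ m.+1 *m A ^ (- m.+1%:Z) = 1%:M.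
  by rewrite -[LHS](exprzDr uA m.+1%:Z) subrr expr0z.
by rewrite -[in LHS]E mulmxA AV mul1mx.
Qed.

Lemma flip_mx22 (B W : 'M[int]_2) :
    B \in unitmx -> W \in unitmx ->
    \det (1%:M - B) != 0 -> \det ((-1)%:M - B) != 0 -> B *m W *m B = W ->
  \det (1%:M - W) = 1 + \det W /\ \det (1%:M - B *m W) = 1 + \det W.
Proof.
rewrite !det_scalar_sub_mx22 => uB uW B1 BN1 BWB.
set d := \det B in B1 BN1 *; set t := \tr B in B1 BN1 *.
have dE : d = 1 \/ d = -1.
  by move: uB; rewrite unitmxE => /orP[] /eqP; [left|right].
(* [B W B = W] multiplied by the adjugate [t - B] of [B] *)
have BW : d *: (B *m W) = t *: W - W *m B.
  have := congr1 (mulmx^~ (\adj B)) BWB; rewrite /= -(mulmxA (B *m W)).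
  rewrite mul_mx_adj adj_mx22.
  by rewrite mul_mx_scalar mulmxBr mul_mx_scalar.
(* Right multiplication by W^-1 and the trace give d t = 2 t - t. *)
have dt : d * t = t.
  have := congr1 (fun X => \tr (X *m invmx W)) BW.
  rewrite -scalemxAl mulmxK // mulmxBl -scalemxAl mulmxV // linearZ linearB /=.
  rewrite linearZ /= mxtrace1 -mulmxA mxtrace_mulC -mulmxA mulVmx // mulmx1.
  by rewrite -/t /GRing.scale /=; lia.
(* If d = -1 then t = 0, and det(1 - B) = 1 - t + d would vanish. *)
have d1 : d = 1 by case: dE => // dE; move: B1 dt; rewrite dE; lia.
set w := \tr W; set x := \tr (B *m W).
have e1 : x = t * w - x.
  have := congr1 mxtrace BW; rewrite d1 scale1r linearB linearZ /=.
  by rewrite (mxtrace_mulC W) -/x -/w.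
have e2 : w = t * x - w.
  have := congr1 (fun X => \tr (X *m B)) BW.
  rewrite d1 scale1r BWB mulmxBl -scalemxAl linearB linearZ /=.
  rewrite (mxtrace_mulC W) -/x -/w (mxtrace_mulC (W *m B)) mulmxA.
  by rewrite BWB.
(* With d = 1, det(1 - B) = 2 - t and det(-1 - B) = 2 + t. The equations 2 x = t w and 2 w = t x
   then give (t^2 - 4) w = 0. *)
have tt : (t - 2) * (t + 2) != 0.
  by rewrite mulf_neq0 //; move: B1 BN1; rewrite d1; lia.
have w0 : w = 0.
  have /eqP : (t - 2) * (t + 2) * w = 0 by nia.
  by rewrite mulf_eq0 (negPf tt) => /eqP.
have x0 : x = 0 by rewrite w0 in e1; lia.
by rewrite w0 x0 det_mulmx -/d d1 expr1n !mulr0 !subr0 mul1r.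
Qed.

(** In the basis given by P the relation becomes E N E = N. Its lower-left block reads B Z = Z,
    which kills Z; the lower-right block then reads B W B = W, and both determinants split along the
    diagonal blocks. *)
Lemma conj_ublock_flip (n : nat) (C : 'rV[int]_n) (B : 'M[int]_n)
    (A P M : 'M[int]_(1 + n)) :
    P \in unitmx -> M \in unitmx -> \det (1%:M - B) != 0 ->
    A = P *m block_mx 1%:M C 0 B *m invmx P -> A *m M *m A = M ->
  exists (c : int) (W : 'M[int]_n),
    [/\ c = 1 \/ c = -1, W \in unitmx, B *m W *m B = W,
        \det (1%:M - M) = (1 - c) * \det (1%:M - W) &
        \det (1%:M - A *m M) = (1 - c) * \det (1%:M - B *m W)].
Proof.
move=> uP uM B1; set E := block_mx _ _ _ _ => AE AMA.
pose N := invmx P *m M *m P.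
have ME : M = P *m N *m invmx P by rewrite /N !mulmxA mulmxV // mul1mx mulmxK.
have AME : A *m M = P *m (E *m N) *m invmx P.
  by rewrite AE ME !mulmxA mulmxKV.
have ENE : E *m N *m E = N.
  rewrite -[RHS]/(invmx P *m M *m P) -[in RHS]AMA AME AE !mulmxA !mulmxKV //.
  by rewrite mulVmx // mul1mx.
have uN : N \in unitmx by rewrite !unitmx_mul unitmx_inv uP uM.
rewrite AME ME !det_sub_conj //.
move: ENE uN; rewrite -[N]submxK.
move: (ulsubmx N) (ursubmx N) (dlsubmx N) (drsubmx N) => X Y Z W.
rewrite /E !mulmx_block !mul1mx !mul0mx !add0r !mulmx1 !mulmx0 !addr0.
case/eq_block_mx=> _ _ BZ.
have Z0 : Z = 0.
  (* Over the integers 1 - B need not be invertible, so its adjugate is used and the nonzero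
     determinant cancelled. *)
  have : (1%:M - B) *m Z = 0 by rewrite mulmxBl mul1mx BZ subrr.
  move/(congr1 (mulmx (\adj (1%:M - B)))); rewrite mulmxA mul_adj_mx mulmx0.
  rewrite mul_scalar_mx => /matrixP dZ; apply/matrixP=> i j.
  have := dZ i j; rewrite !mxE => /eqP.
  by rewrite mulf_eq0 (negPf B1) => /eqP.
rewrite Z0 !mulmx0 mul0mx add0r addr0 => BWB.
rewrite unitmxE det_ublock unitrM det_mx11 => /andP[uX uW].
exists (X 0 0), W; split=> //.
- by case/orP: uX => /eqP; [left|right].
- rewrite (scalar_mx_block 1 n) opp_block_mx add_block_mx oppr0 addr0.
  by rewrite det_ublock det_mx11 !mxE.
- rewrite (scalar_mx_block 1 n) opp_block_mx add_block_mx oppr0 addr0.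
  by rewrite det_ublock det_mx11 !mxE.
Qed.

(** Eigenvectors are row vectors here, so v extends by a zero first entry to an eigenvector of the
    block matrix. *)
Lemma eigenvalue_conj_ublock (n : nat) (C : 'rV[int]_n) (B : 'M[int]_n)
    (A P : 'M[int]_(1 + n)) (a : algC) :
    P \in unitmx -> A = P *m block_mx 1%:M C 0 B *m invmx P ->
  eigenvalue (map_mx intr B) a -> eigenvalue (map_mx intr A) a.
Proof.
move=> uP -> /eigenvalueP[v vB vN0]; apply/eigenvalueP.
have PV : map_mx (intr : int -> algC) (invmx P) *m map_mx intr P = 1%:M.
  by rewrite -map_mxM mulVmx // map_mx1.
exists (row_mx 0 v *m map_mx intr (invmx P)).
  rewrite !map_mxM !mulmxA -(mulmxA _ _ (map_mx _ P)) PV mulmx1 map_block_mx.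
  rewrite map_mx0 mul_row_block !mul0mx mulmx0 !add0r vB scalemxAl.
  by rewrite scale_row_mx scaler0.
apply: contra_neq vN0 => /(congr1 (mulmx^~ (map_mx intr P))).
rewrite /= -mulmxA PV mulmx1 mul0mx => v0.
by move: v0; rewrite -[0 in RHS]row_mx0 => /eq_row_mx[].
Qed.

End Matrices.

Theorem proposition5p8
    (A : 'M[int]_3) (uA : A \in unitmx)
    (C : 'rV[int]_2) (A' : 'M[int]_2) (uA' : A' \in unitmx)
    (eigA' : forall a : algC,
       eigenvalue (map_mx intr A' : 'M[algC]_2) a ->
       [/\ a \is Num.real, a != 1 & a != -1])
    (conjA : exists2 P : 'M[int]_3, P \in unitmx &
       A = P *m (block_mx (1%:M : 'M[int]_1) C 0 A' : 'M[int]_3) *m invmx P) :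
  (reidemeister_spectrum (semidirect uA) = [set +oo%E] \/
   reidemeister_spectrum (semidirect uA) = [set EFin 8%N; +oo%E]) /\
  (R_infinity (semidirect uA') -> R_infinity (semidirect uA)).
Proof.
have detA'1 : \det (1%:M - A') != 0.
  by apply/eqP=> /eigenvalue_det_sub /eigA'[_]; rewrite eqxx.
have detA'N1 : \det ((-1)%:M - A') != 0.
  by apply/eqP=> /eigenvalue_det_sub /eigA'[_ _]; rewrite mulrN1z eqxx.
have [P uP AE] := conjA.
have A_free k : A ^ k *m (A - 1) = A - 1 -> k = 0.
  have [a eiga] := eigenvalue_closed (map_mx intr A' : 'M[algC]_2) isT.
  have [a_real a1 aN1] := eigA' a eiga.
  apply: eigenvalue_free uA _ a_real a1 aN1.
  exact: eigenvalue_conj_ublock uP AE eiga.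
have spec (phi : {multiplicative semidirect uA -> semidirect uA}) :
    bijective phi -> reidemeister_number phi = +oo%E \/
    reidemeister_number phi = EFin 8%N /\
    exists W : 'M_2, [/\ W \in unitmx, A' *m W *m A' = W & \det W = 1].
  case/(automorphism_structure)=> // M [e [uM e_unit phiM phi2 MA]].
  case: e_unit => eE; rewrite eE in phi2 MA.
    by left; apply: reidemeister_number_fix => x; rewrite phi2 mul1r.
  have {}phi2 x : (phi x).2 = - x.2 by rewrite phi2 mulN1r.
  have AMA : A *m M *m A = M.
    by rewrite -mulmxA MA mulmxA exprN1 [A *m _](mulmxV uA) mul1mx.
  have [c [W [c_unit uW BWB detM detAM]]] := conj_ublock_flip uP uM detA'1 AE AMA.
  have [detW detBW] := flip_mx22 uA' uW detA'1 detA'N1 BWB.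
  have {detW}detM : \det (1 - M) = (1 - c) * (1 + \det W) by rewrite -detW.
  have {detBW}detAM : \det (1 - A *m M) = (1 - c) * (1 + \det W) by rewrite -detBW.
  have infinite : \det (1 - M) = 0 -> reidemeister_number phi = +oo%E.
    move=> det0; apply: (reidemeister_number_flip_infinite phiM phi2 (b := false)).
    by rewrite expr0 mul1mx.
  case: c_unit => cE; rewrite cE in detM detAM.
    by left; apply: infinite; rewrite detM subrr mul0r.
  have /orP[/eqP W1|/eqP W1] : (\det W == 1) || (\det W == -1).
  - by rewrite unitmxE in uW.
  (* With c = -1 and det W = 1 both determinants equal 4, hence 8 = 4 + 4. *)
  - right; split; last by exists W.
    by rewrite (reidemeister_number_flip phiM phi2 detM detAM) W1.
  by left; apply: infinite; rewrite detM W1 subrr mulr0.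
have spec_oo : reidemeister_spectrum (semidirect uA) +oo%E.
  exists (idfun : semidirect uA -> semidirect uA); first by exists id.
  by apply/esym/reidemeister_number_fix.
split.
  (* Infinity is always attained, by the identity, so only the presence of 8 remains to be
     decided. *)
  case: (pselect (reidemeister_spectrum (semidirect uA) (EFin 8%N))) => spec8.
    right; apply/seteqP; split=> r /=; last by case=> ->.
    by case=> phi /spec[->|[-> _]] ->; [right|left].
  left; apply/seteqP; split=> r /=; last by move=> ->.
  case=> phi phi_bij ->; case: (spec phi phi_bij) => [//|[phi8 _]].
  by case: spec8; exists phi.
move=> R_A'; apply/seteqP; split=> r /=; last by move=> ->.
case=> phi phi_bij ->; case: (spec phi phi_bij) => [//|[_ [W [uW BWB detW]]]].
have WA' : W *m A' = A' ^ (-1) *m W.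
  by rewrite exprN1 -{2}BWB -mulmxA; apply/esym/mulKmx.
have [psi [psi_bij psiM psi2]] := flip_multiplicative uA' uW WA'.
have : reidemeister_spectrum (semidirect uA') (reidemeister_number psi).
  by exists psi.
(* Both determinants for [psi] equal 1 + det W = 2, so its Reidemeister number is finite,
   contradicting [R_A']. *)
have [detW1 detBW1] := flip_mx22 uA' uW detA'1 detA'N1 BWB.
by rewrite R_A' /= (reidemeister_number_flip psiM psi2 detW1 detBW1) detW.
Qed.
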